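(* For every integer $n\ge1$, \[ \mathrm{QEC}(K_1+P_n)=-\tilde\alpha_n-2, \] where $\tilde\alpha_n$ is the minimal root of $\Phi_n(x)=0$. If $n\ge2$ is even, then $\tilde\alpha_n=\min\mathrm{ev}(A_n)$ and \[ \mathrm{QEC}(K_1+P_n)=-\min\mathrm{ev}(A_n)-2=-4\sin^2\frac{\pi}{2(n+1)}. \] If $n\ge1$ is odd, then $\min\mathrm{ev}(A_{n+1})\le\tilde\alpha_n<\min\mathrm{ev}(A_n)$ and \[ -4\sin^2\frac{\pi}{2(n+1)}<\mathrm{QEC}(K_1+P_n)\le-4\sin^2\frac{\pi}{2(n+2)}. \]
   Context: For a finite connected graph $G=(V,E)$ with $|V|\ge2$ and distance matrix $D=[d(i,j)]_{i,j\in V}$ (graph distance), the quadratic embedding constant is $\mathrm{QEC}(G)=\max\{\langle f,Df\rangle : f\in\mathbb{R}^V,\ \langle f,f\rangle=1,\ \langle\mathbf 1,f\rangle=0\}$, where $\mathbf 1$ is the all-ones vector and $\langle\cdot,\cdot\rangle$ the standard inner product. The join $G_1+G_2$ of disjoint graphs has vertex set $V_1\cup V_2$ and edge set $E_1\cup E_2\cup\{\{x,y\}:x\in V_1,y\in V_2\}$. $K_1$ is the one-vertex graph and $P_n$ the path on $n$ vertices; $A_n$ is the adjacency matrix of $P_n$ and $\mathrm{ev}(A_n)$ its set of eigenvalues. $U_n$ is the Chebyshev polynomial of the second kind, $U_n(\cos\theta)=\sin((n+1)\theta)/\sin\theta$, and $\tilde U_n(x)=U_n(x/2)$. Define \[ \Phi_n(x)=((n+1)x^2-6x-4n)\tilde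 U_n(x)+2(x+2)\tilde U_{n-1}(x)+2(x+2). \] (All roots of $\Phi_n$ are real.) *)

(* Defs.v *)
From HB Require Import structures.
From mathcomp Require Import all_boot all_order all_algebra.
From mathcomp Require Import all_classical all_reals all_analysis.
Set Implicit Arguments. Unset Strict Implicit. Unset Printing Implicit Defensive.
Import Order.TTheory GRing.Theory Num.Theory.
Local Open Scope ring_scope.
Local Open Scope classical_set_scope.

(* Graph distance: the least k such that there is a walk x = v0, v1, ..., vk = y
   (the walk is x :: p with p a k-tuple).  Searched over k < #|T|; for a connected
   graph the distance is always < #|T| (if unreachable the value is #|T|). *)
Definition gdist (T : finType) (e : rel T) (x y : T) : nat :=
  find (fun k => [exists p : k.-tuple T, path e x p && (last x p == y)])
       (iota 0 #|T|).

Definition QEC (R : realType) (T : finType) (e : rel T) : R :=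
  sup [set q : R | exists f : T -> R,
        [/\ \sum_(x : T) f x ^+ 2 = 1, \sum_(x : T) f x = 0 &
            q = \sum_(x : T) \sum_(y : T) f x * (gdist e x y)%:R * f y]].

Definition join_rel (T1 T2 : finType) (e1 : rel T1) (e2 : rel T2) : rel (T1 + T2) :=
  fun u v => match u, v with
             | inl x, inl y => e1 x y
             | inr x, inr y => e2 x y
             | _, _ => true
             end.

Definition K1_rel : rel unit := fun _ _ => false.

Definition path_rel (n : nat) : rel 'I_n :=
  fun i j => (i.+1 == j :> nat) || (j.+1 == i :> nat).

Definition adjP (R : realType) (n : nat) : 'M[R]_n :=
  \matrix_(i < n, j < n) (path_rel i j)%:R.

Definition min_ev (R : realType) (n : nat) (A : 'M[R]_n) : R :=
  inf [set a : R | eigenvalue A a].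

(* Chebyshev polynomials of the second kind:
   U_0 = 1, U_1 = 2x, U_{k+2} = 2x U_{k+1} - U_k (so U_k(cos t) = sin((k+1)t)/sin t). *)
Fixpoint chebU (R : realType) (k : nat) (x : R) : R :=
  match k with
  | 0 => 1
  | 1 => 2 * x
  | (k'.+1 as k1).+1 => 2 * x * chebU k1 x - chebU k' x
  end.

Definition chebUt (R : realType) (k : nat) (x : R) : R := chebU k (x / 2).

Definition Phi (R : realType) (n : nat) (x : R) : R :=
  ((n.+1)%:R * x ^+ 2 - 6 * x - 4 * n%:R) * chebUt n x
  + 2 * (x + 2) * chebUt n.-1 x + 2 * (x + 2).

Definition alpha_t (R : realType) (n : nat) : R := inf [set x : R | Phi n x = 0].

Definition QEC_K1Pn (R : realType) (n : nat) : R := @QEC R _ (join_rel K1_rel (@path_rel n)).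

(* Main.v *)
(* On the vectors f = (f_0, g) of sum zero, the distance matrix 2J - 2I - A of the join acts
   as -2I - A, and f_0 = - sum g can be eliminated.  Hence QEC <= r iff the matrix
   [fan x] = A_n - x I - (x + 2) J is positive semidefinite for x = - r - 2, and m = - QEC - 2
   is the largest such x.  By maximality [fan m] is singular, while [fan y] is definite for
   y < m.  A kernel vector of [fan x] solves a three-term recurrence with constant right-hand
   side, so it is C (1 - U_k) + B U_{k-1}; the boundary condition and the value of its sum form
   a 2 x 2 system in (C, B) whose determinant, after scaling by 2 - x, is Phi_n(x).  This makes
   m the minimal root of Phi_n.  To locate m, test the eigenvector (-1)^k sin (k pi / (n + 1)) of
   A_n: its sum vanishes iff n is even, whence m <= min ev A_n, strictly for odd n.  For even n
   equality follows from Cauchy-Schwarz with the explicit solution of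
   (A_n - min ev A_n) h = 1, and m is nonincreasing in n by zero extension. *)
Require Import Defs.
From HB Require Import structures.
From mathcomp Require Import all_boot all_order all_algebra.
From mathcomp Require Import all_classical all_reals all_analysis.
From mathcomp Require Import ring lra.
Import Order.TTheory GRing.Theory Num.Theory numFieldNormedType.Exports.
Local Open Scope ring_scope.
Set Implicit Arguments. Unset Strict Implicit. Unset Printing Implicit Defensive.

(** * Positive semidefinite forms *)

Definition bform (R : realType) (n : nat) (M : 'M[R]_n) (u v : 'cV[R]_n) : R :=
  (u^T *m M *m v) 0 0.

Definition psd (R : realType) (n : nat) (M : 'M[R]_n) : Prop :=
  forall v : 'cV[R]_n, 0 <= bform M v v.

Lemma bformE (R : realType) (n : nat) (M : 'M[R]_n) (u v : 'cV[R]_n) :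
  bform M u v = \sum_(i < n) u i 0 * (M *m v) i 0.
Proof. by rewrite /bform -mulmxA mxE; apply: eq_bigr => i _; rewrite mxE. Qed.

Lemma bformC (R : realType) (n : nat) (M : 'M[R]_n) (u v : 'cV[R]_n) :
  M^T = M -> bform M u v = bform M v u.
Proof.
by move=> MT; rewrite /bform -[in LHS](trmxK (_ *m _ *m v)) mxE !trmx_mul trmxK MT mulmxA.
Qed.

(** The form of [u + t *: v] is a quadratic in [t] that is never negative. As [M] is only
    semidefinite, the case where the form vanishes at [v] is treated apart. *)
Lemma cauchy_schwarz_psd (R : realType) (n : nat) (M : 'M[R]_n) (u v : 'cV[R]_n) :
  M^T = M -> psd M -> bform M u v ^+ 2 <= bform M u u * bform M v v.
Proof.
move=> MT M0.
have quad t : 0 <= bform M u u + 2 * t * bform M u v + t ^+ 2 * bform M v v.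
  have -> : bform M u u + 2 * t * bform M u v + t ^+ 2 * bform M v v
            = bform M (u + t *: v) (u + t *: v); last exact: M0.
  rewrite {4}/bform; rewrite [(u + t *: v)^T]linearD !linearZ /=.
  rewrite !mulmxDl !mulmxDr -!scalemxAl -!scalemxAr.
  have D (a b : 'M[R]_1) : (a + b) 0 0 = a 0 0 + b 0 0 by rewrite mxE.
  have Z s (a : 'M[R]_1) : (s *: a) 0 0 = s * a 0 0 by rewrite mxE.
  rewrite !D !Z -!/(bform _ _ _) (bformC v u MT); ring.
have := M0 v; rewrite le_eqVlt => /predU1P[v0|v_gt0].
  rewrite -v0 mulr0; case: (eqVneq (bform M u v) 0) => [->|uv0]; first by rewrite expr0n.
  (* The quadratic is now affine in [t], and this [t] would give it the value -1. *)
  have := quad (- (bform M u u + 1) / (2 * bform M u v)).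
  rewrite -v0 mulr0 addr0.
  have -> : 2 * (- (bform M u u + 1) / (2 * bform M u v)) * bform M u v = - (bform M u u + 1).
    by field.
  lra.
have := quad (- bform M u v / bform M v v).
set a := bform M u u; set b := bform M u v; set c := bform M v v in v_gt0 *.
have -> : a + 2 * (- b / c) * b + (- b / c) ^+ 2 * c = (a * c - b ^+ 2) / c.
  by field; rewrite gt_eqF.
by rewrite pmulr_lge0 ?invr_gt0// subr_ge0.
Qed.

Lemma bform_le (R : realType) (n : nat) (M : 'M[R]_n) :
  exists2 C : R, 0 < C & forall v : 'cV[R]_n, bform M v v <= C * \sum_(i < n) v i 0 ^+ 2.
Proof.
exists (1 + \sum_(i < n) \sum_(j < n) `|M i j|) => [|v].
  by rewrite ltr_pwDl// sumr_ge0// => i _; rewrite sumr_ge0.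
have sq_le (i : 'I_n) : v i 0 ^+ 2 <= \sum_(i < n) v i 0 ^+ 2.
  by rewrite (bigD1 i)//= lerDl sumr_ge0// => j _; rewrite sqr_ge0.
rewrite mulrDl mul1r ler_wpDl ?sumr_ge0// => [i _|]; first exact: sqr_ge0.
rewrite bformE mulr_suml ler_sum// => i _; rewrite mxE mulr_sumr mulr_suml ler_sum// => j _.
rewrite mulrCA; apply: le_trans (ler_norm _) _; rewrite normrM ler_wpM2l// normrM.
have := sq_le i; have := sq_le j; rewrite -(normr_id (v i 0)) -(normr_id (v j 0)).
have := sqr_ge0 (`|v i 0| - `|v j 0|).
rewrite -[v i 0 ^+ 2]real_normK ?num_real// -[v j 0 ^+ 2]real_normK ?num_real//.
rewrite !normr_id; set S := \sum_(_ < _) _; nra.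
Qed.

(** With [N] the squared norm of [v], Cauchy-Schwarz for [v] and [invmx M *m v] gives [N ^+ 2 <=
    bform M v v * bform (invmx M) v v], and the last factor is at most [C * N]. *)
Lemma psd_unit_coercive (R : realType) (n : nat) (M : 'M[R]_n) :
  M^T = M -> psd M -> M \in unitmx ->
  exists2 c : R, 0 < c & forall v : 'cV[R]_n, c * \sum_(i < n) v i 0 ^+ 2 <= bform M v v.
Proof.
move=> MT M0 Mu; have [C C0 leC] := bform_le (invmx M); exists C^-1 => [|v].
  by rewrite invr_gt0.
set N := \sum_(i < n) _; rewrite ler_pdivrMl//.
have N0 : 0 <= N by rewrite sumr_ge0// => i _; rewrite sqr_ge0.
have := cauchy_schwarz_psd v (invmx M *m v) MT M0.
have -> : bform M v (invmx M *m v) = N.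
  by rewrite bformE mulKVmx//; apply: eq_bigr => i _; rewrite expr2.
have -> : bform M (invmx M *m v) (invmx M *m v) = bform (invmx M) v v.
  by rewrite bformE mulKVmx// bformE; apply: eq_bigr => i _; rewrite mulrC.
have := leC v; rewrite -/N; have := M0 v.
move: N0; rewrite le_eqVlt => /predU1P[<-|N0].
  by move=> a0 _ _; exact: mulr_ge0 (ltW C0) a0.
move=> a0 b_le ab; rewrite -(ler_pM2r N0); nra.
Qed.

(** * The quadratic form of the fan graph *)

Definition fan (R : realType) (n : nat) (x : R) : 'M[R]_n :=
  adjP R n - x%:M - (x + 2) *: const_mx 1.
Arguments fan {R} n x.

Lemma sum_ord_delta (R : realType) (n k : nat) (F : nat -> R) :
  \sum_(j < n) (k == j :> nat)%:R * F j = if (k < n)%N then F k else 0.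
Proof.
case: ltnP => [k_lt|k_ge].
  rewrite (bigD1 (Ordinal k_lt))//= eqxx mul1r big1 ?addr0// => j jk.
  by case: eqP => [kj|]; [move: jk; rewrite -val_eqE /= kj eqxx | rewrite mul0r].
by rewrite big1// => j _; rewrite gtn_eqF ?mul0r// (leq_trans (ltn_ord j)).
Qed.

Lemma adjP_sym (R : realType) (n : nat) : (adjP R n)^T = adjP R n.
Proof. by apply/matrixP => i j; rewrite !mxE /path_rel orbC. Qed.

(** Coordinate [i] is stored as [u i.+1]; zeros at [0] and [n.+1] then let the end vertices obey the
    same formula as the inner ones. *)
Lemma adjP_col (R : realType) (n : nat) (u : nat -> R) : u 0 = 0 -> u n.+1 = 0 ->
  adjP R n *m \col_(i < n) u i.+1 = \col_(i < n) (u i + u i.+2).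
Proof.
move=> u0 un; apply/matrixP => i k; rewrite !mxE.
have pathE (j : 'I_n) :
    (path_rel i j)%:R * u j.+1 = (i == j.+1 :> nat)%:R * u j.+1 + (i.+1 == j)%:R * u j.+1.
  rewrite -mulrDl /path_rel [j.+1 == i]eq_sym orbC.
  by case: eqP => [->|] /=; rewrite ?add0r// gtn_eqF ?addr0//.
under eq_bigr => j _ do rewrite !mxE pathE.
rewrite big_split /= (sum_ord_delta n i.+1 (fun k => u k.+1)); congr (_ + _).
  case: i {pathE} => [[|i] i_lt] /=; first by rewrite u0 big1// => j _; rewrite mul0r.
  by under eq_bigr => j _ do rewrite eqSS; rewrite (sum_ord_delta n i (fun k => u k.+1)) ltnW.
case: ltnP => // n_le; suff -> : i.+2 = n.+1 by [].
by congr _.+1; apply/eqP; rewrite eqn_leq ltn_ord.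
Qed.

(** The zeros continue beyond [n.+1] because [psd_fan_pred] reads the same sequence in one dimension
    more. *)
Lemma col_ext (R : realType) (n : nat) (v : 'cV[R]_n) : exists u : nat -> R,
  [/\ u 0 = 0, forall k, (n < k)%N -> u k = 0 & v = \col_(i < n) u i.+1].
Proof.
exists (fun k => if k is k'.+1 then oapp (v^~ 0) 0 (insub k') else 0); split=> //.
  by case=> // k nk; rewrite insubN// -leqNgt.
by apply/matrixP => i j; rewrite mxE ord1 valK.
Qed.

Lemma fan_sym (R : realType) (n : nat) (x : R) : (fan n x)^T = fan n x.
Proof.
by rewrite /fan !linearB /= adjP_sym tr_scalar_mx linearZ /= trmx_const.
Qed.

Lemma fan_mulE (R : realType) (n : nat) (x : R) (v : 'cV[R]_n) (i : 'I_n) :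
  (fan n x *m v) i 0 = (adjP R n *m v) i 0 - x * v i 0 - (x + 2) * \sum_(j < n) v j 0.
Proof.
rewrite /fan !mulmxBl mul_scalar_mx -scalemxAl !mxE; congr (_ - _ - _ * _).
by apply: eq_bigr => j _; rewrite mxE mul1r.
Qed.

Lemma fan_col (R : realType) (n : nat) (x : R) (u : nat -> R) (i : 'I_n) :
  u 0 = 0 -> u n.+1 = 0 ->
  (fan n x *m \col_(i < n) u i.+1) i 0
  = u i + u i.+2 - x * u i.+1 - (x + 2) * \sum_(j < n) u j.+1.
Proof.
move=> u0 un; rewrite fan_mulE adjP_col// !mxE; congr (_ - _ * _).
by apply: eq_bigr => j _; rewrite mxE.
Qed.

(** The factor of [x] is the squared norm of [v] extended to the hub by minus its sum, so for
    [v != 0] the form strictly decreases in [x]. *)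
Lemma bform_fan (R : realType) (n : nat) (x : R) (v : 'cV[R]_n) :
  bform (fan n x) v v = bform (adjP R n) v v - 2 * (\sum_(i < n) v i 0) ^+ 2
    - x * (\sum_(i < n) v i 0 ^+ 2 + (\sum_(i < n) v i 0) ^+ 2).
Proof.
rewrite !bformE; under eq_bigr => i _.
  by rewrite fan_mulE !mulrBr (mulrCA (v i 0)) -expr2; over.
rewrite !sumrB -mulr_sumr -mulr_suml; ring.
Qed.

(** * Distances in the join and the reduction of QEC to the fan form *)

(** Distinct nonadjacent vertices both lie on the path and have the hub [inl tt] as common
    neighbour. *)
Lemma gdist_join (n : nat) (x y : unit + 'I_n) : (0 < n)%N ->
  gdist (join_rel K1_rel (@path_rel n)) x y
  = if x == y then 0%N else if join_rel K1_rel (@path_rel n) x y then 1%N else 2%N.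
Proof.
case: n x y => // n x y _; rewrite /gdist card_sum card_unit card_ord add1n.
set e := join_rel _ _; set P := fun k => _.
have P0 : P 0%N = (x == y).
  apply/existsP/idP => [[p]|xy]; first by rewrite tuple0.
  by exists [tuple]; rewrite /= xy.
have P1 : P 1%N = e x y.
  apply/existsP/idP => [[[[|z []]//= _]]|xy].
    by rewrite andbT => /andP[xz /eqP <-].
  by exists [tuple y]; rewrite /= xy eqxx.
have P2 z : e x z -> e z y -> P 2%N.
  by move=> xz zy; apply/existsP; exists [tuple z; y]; rewrite /= xz zy eqxx.
have -> : find P (iota 0 n.+2) = if x == y then 0%N else if e x y then 1%N
    else (find P (iota 2 n)).+2.
  by rewrite -P0 -P1 /=; case: (P 0%N); case: (P 1%N).
case: (boolP (x == y)) => // xy; case: ifP => // exy; congr _.+2.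
move: P2 xy exy; case: n x y @e @P {P0 P1} => [|n] [[]|i] [[]|j] e P P2 //=.
by rewrite (P2 (inl tt)).
Qed.

Lemma big_unit_sum (R : realType) (n : nat) (F : unit + 'I_n -> R) :
  \sum_x F x = F (inl tt) + \sum_(i < n) F (inr i).
Proof. by rewrite big_sumType (big_pred1 tt)// => -[]. Qed.

(** With [s] the sum over the path, the hub edges contribute [2 * f (inl tt) * s] to the adjacency
    form, and [f (inl tt) = - s]. *)
Lemma QEC_form (R : realType) (n : nat) (f : unit + 'I_n -> R) :
  (0 < n)%N -> \sum_x f x = 0 ->
  \sum_x \sum_y f x * (gdist (join_rel K1_rel (@path_rel n)) x y)%:R * f y
  = - 2 * \sum_x f x ^+ 2
    - (bform (adjP R n) (\col_i f (inr i)) (\col_i f (inr i))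
       - 2 * (\sum_(i < n) f (inr i)) ^+ 2).
Proof.
move=> n_gt0 f0; set e := join_rel _ _.
have distE x y : f x * (gdist e x y)%:R * f y
    = f x * (2 * f y) - f x * (2 * ((y == x)%:R * f y)) - f x * ((e x y)%:R * f y).
  have exx z : e z z = false by case: z => //= i; rewrite /path_rel gtn_eqF.
  rewrite gdist_join// [y == x]eq_sym -/e.
  by have [->|xy] := eqVneq; rewrite ?exx; [|case: (e x y)] => /=; ring.
have innerE x : \sum_y f x * (gdist e x y)%:R * f y
    = - 2 * f x ^+ 2 - f x * \sum_y (e x y)%:R * f y.
  under eq_bigr => y _ do rewrite distE.
  rewrite !sumrB -!mulr_sumr f0 (bigD1 x)//= eqxx mul1r big1 => [|y /negPf ->].
    by ring.
  by rewrite mul0r.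
under eq_bigr => x _ do rewrite innerE.
rewrite sumrB -mulr_sumr; congr (_ - _); move: f0.
rewrite !big_unit_sum /= => f0.
rewrite mul0r add0r; under eq_bigr => i _ do rewrite mul1r.
under [X in _ + X = _]eq_bigr => i _.
  rewrite big_unit_sum /= mul1r mulrDr; over.
rewrite big_split /= -mulr_suml bformE.
under [X in _ = X - _]eq_bigr => i _.
  rewrite !mxE; under eq_bigr => j _ do rewrite !mxE; over.
have -> : f (inl tt) = - \sum_(i < n) f (inr i) by apply/eqP; rewrite -addr_eq0 f0.
ring.
Qed.

(** The set under [sup] in [QEC], spelled out so that [QEC_K1Pn] is its supremum by conversion. *)
Definition qec_set (R : realType) (n : nat) : set R :=
  [set q : R | exists f : unit + 'I_n -> R,
    [/\ \sum_x f x ^+ 2 = 1, \sum_x f x = 0 &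
        q = \sum_x \sum_y f x * (gdist (join_rel K1_rel (@path_rel n)) x y)%:R * f y]].

Lemma qec_set_fan (R : realType) (n : nat) (q : R) : (0 < n)%N -> qec_set n q ->
  exists v : 'cV[R]_n, forall r, bform (fan n (- r - 2)) v v = r - q.
Proof.
move=> n_gt0 [f [f1 f0 ->]]; exists (\col_i f (inr i)) => r.
rewrite QEC_form// f1 bform_fan; move: f1 f0; rewrite !big_unit_sum.
under [X in _ - _ * X ^+ 2 - _]eq_bigr => i _ do rewrite mxE.
under [X in _ - _ * (X + _)]eq_bigr => i _ do rewrite mxE.
under [X in _ - _ * (_ + X ^+ 2)]eq_bigr => i _ do rewrite mxE.
set s := \sum_(i < n) f _; set s2 := \sum_(i < n) f _ ^+ 2 => + f0.
have -> : f (inl tt) = - s by apply/eqP; rewrite -addr_eq0 f0.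
rewrite sqrrN addrC => ->; ring.
Qed.

(** The hub receives minus the sum of [v], and [N] is the squared norm of this extension, hence the
    scaling by [Num.sqrt N]. *)
Lemma fan_qec_set (R : realType) (n : nat) (v : 'cV[R]_n) :
  let N := \sum_(i < n) v i 0 ^+ 2 + (\sum_(i < n) v i 0) ^+ 2 in
  (0 < n)%N -> 0 < N ->
  exists2 q, qec_set n q & forall r, bform (fan n (- r - 2)) v v = N * (r - q).
Proof.
move=> N n_gt0 N_gt0; set s := \sum_(i < n) v i 0.
pose f (x : unit + 'I_n) := (if x is inr i then v i 0 else - s) / Num.sqrt N.
have sq_gt0 : 0 < Num.sqrt N by rewrite sqrtr_gt0.
have sqN : Num.sqrt N ^+ 2 = N by rewrite sqr_sqrtr ?ltW.
have f1 : \sum_x f x ^+ 2 = 1.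
  rewrite big_unit_sum /f; under eq_bigr => i _ do rewrite expr_div_n sqN.
  by rewrite expr_div_n sqrrN sqN -mulr_suml -mulrDl addrC mulfV// gt_eqF.
have f0 : \sum_x f x = 0.
  by rewrite big_unit_sum /f -mulr_suml -mulrDl addNr mul0r.
have qS : qec_set n (\sum_x \sum_y
    f x * (gdist (join_rel K1_rel (@path_rel n)) x y)%:R * f y) by exists f.
eexists; first exact: qS.
move=> r; rewrite QEC_form// f1 bform_fan -/s.
have -> : \col_i f (inr i) = (Num.sqrt N)^-1 *: v.
  by apply/matrixP => i j; rewrite !mxE ord1 mulrC.
rewrite -/N /f -mulr_suml -/s expr_div_n sqN.
have bformZ (A : 'M[R]_n) (c : R) : bform A (c *: v) (c *: v) = c ^+ 2 * bform A v v.
  by rewrite /bform -scalemxAr [(c *: v)^T]linearZ /= -!scalemxAl scalerA mxE expr2.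
by rewrite bformZ exprVn sqN; field; rewrite gt_eqF.
Qed.

Lemma sum_sq_gt0 (R : realType) (n : nat) (v : 'cV[R]_n) :
  v != 0 -> 0 < \sum_(i < n) v i 0 ^+ 2.
Proof.
move=> v0; have [i vi] : exists i, v i 0 != 0.
  by apply/existsP; apply: contraNT v0 => /existsPn v0; apply/eqP/matrixP => i j;
    rewrite ord1 mxE; apply/eqP; rewrite -[_ == _]negbK.
rewrite (bigD1 i)//= ltr_pwDl ?exprn_even_gt0// sumr_ge0// => j _; exact: sqr_ge0.
Qed.

Lemma sum_sq_pwD_gt0 (R : realType) (n : nat) (v : 'cV[R]_n) :
  v != 0 -> 0 < \sum_(i < n) v i 0 ^+ 2 + (\sum_(i < n) v i 0) ^+ 2.
Proof. by move=> v0; rewrite ltr_pwDl ?sum_sq_gt0 ?sqr_ge0. Qed.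

Lemma QEC_fan (R : realType) (n : nat) : (0 < n)%N -> psd (fan n (- 2 : R)) ->
  psd (fan n (- QEC_K1Pn R n - 2)) /\
  forall x : R, psd (fan n x) -> x <= - QEC_K1Pn R n - 2.
Proof.
move=> n_gt0 fan2.
have ubP r : psd (fan n (- r - 2)) -> ubound (@qec_set R n) r.
  by move=> psd_r q /(qec_set_fan n_gt0)[v vE]; rewrite -subr_ge0 -vE.
have [q0 q0S] : exists q, @qec_set R n q.
  have [||q qS _] := @fan_qec_set R n (const_mx 1); [done| |by exists q].
  apply: sum_sq_pwD_gt0; apply/eqP => /matrixP/(_ (Ordinal n_gt0) 0)/eqP.
  by rewrite !mxE oner_eq0.
(* The parameter -2 of the fan form corresponds to the upper bound [r = 0]. *)
have bnd : has_ubound (@qec_set R n) by exists 0; apply: ubP; rewrite oppr0 sub0r.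
have QECE : QEC_K1Pn R n = sup (@qec_set R n) by [].
split=> [v|x psd_x].
  have [->|v0] := eqVneq v 0; first by rewrite /bform mulmx0 mxE.
  have [q qS ->] := fan_qec_set n_gt0 (sum_sq_pwD_gt0 v0).
  apply: mulr_ge0; first exact/ltW/sum_sq_pwD_gt0.
  by rewrite subr_ge0 QECE ub_le_sup.
rewrite QECE lerBrDr lerNr; apply: ge_sup; first by exists q0.
by apply: ubP; rewrite opprK addrK.
Qed.

(* If [fan m] were invertible it would be coercive, leaving room to increase [m]. *)
Lemma fan_max_ker (R : realType) (n : nat) (m : R) : psd (fan n m) ->
  (forall x, psd (fan n x) -> x <= m) -> exists2 v : 'cV[R]_n, v != 0 & fan n m *m v = 0.
Proof.
move=> psd_m max_m.
have [|fanU] := boolP (fan n m \in unitmx); last first.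
  have /det0P[w w0 wM] : \det (fan n m) == 0 by move: fanU; rewrite unitmxE unitfE negbK.
  exists w^T; first by rewrite -trmx_eq0 trmxK.
  by rewrite -(fan_sym n m) -trmx_mul wM trmx0.
move=> /(psd_unit_coercive (fan_sym n m) psd_m)[c c_gt0 coer].
have [C C_gt0 leC] := bform_le (const_mx 1 : 'M[R]_n).
have onesE (v : 'cV[R]_n) : bform (const_mx 1) v v = (\sum_(i < n) v i 0) ^+ 2.
  rewrite bformE expr2 mulr_suml; apply: eq_bigr => i _; congr (_ * _).
  by rewrite mxE; apply: eq_bigr => j _; rewrite mxE mul1r.
(* Raising [x] by [d] lowers the form by [d] times squared norm plus squared sum, at most
   [d * (C + 1)] times the squared norm; this [d] uses up exactly the coercivity constant [c]. *)
suff /max_m : psd (fan n (m + c / (C + 1))) by rewrite gerDl leNgt divr_gt0// addr_gt0.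
move=> v; have := coer v; have := leC v; rewrite onesE !bform_fan.
set N := \sum_(i < n) _ ^+ 2; set s := (\sum_(i < n) _) ^+ 2.
have c'0 : 0 < c / (C + 1) by rewrite divr_gt0// addr_gt0.
have cE : c = c / (C + 1) * (C + 1) by rewrite divfK// gt_eqF// addr_gt0.
move: (c / _) c'0 cE => d d0 ->; nra.
Qed.

(** * Spectrum of the path *)

(** The closed form of the least eigenvalue of the path, identified as such in [min_ev_adjP]. *)
Definition path_min (R : realType) (n : nat) : R := - 2 * cos (pi / n.+1%:R).
Arguments path_min R n : clear implicits.

Lemma sin_le (R : realType) (x : R) : 0 <= x -> sin x <= x.
Proof.
move=> x0; have [|c _ cE] := @MVT_segment R sin cos 0 x x0.
  exact: (continuous_subspaceT (@continuous_sin R)).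
by move: cE; rewrite sin0 !subr0 => ->; rewrite ler_piMl ?cos_le1.
Qed.

Lemma inf_minimum (R : realType) (S : set R) (x : R) : S x -> lbound S x -> inf S = x.
Proof.
move=> Sx lbx; apply/eqP; rewrite eq_le lb_le_inf ?andbT//; last by exists x.
by apply: ge_inf => //; exists x.
Qed.

Lemma sin_recurrence (R : realType) (t : R) (k : nat) :
  sin (k%:R * t) + sin (k.+2%:R * t) = 2 * cos t * sin (k.+1%:R * t).
Proof.
have -> : k%:R * t = k.+1%:R * t - t by rewrite -[k.+1]addn1 natrD; ring.
have -> : k.+2%:R * t = k.+1%:R * t + t by rewrite -[k.+2]addn1 natrD; ring.
rewrite sinB sinD; ring.
Qed.

Lemma cos_recurrence (R : realType) (t : R) (k : nat) :
  cos (k%:R * t) + cos (k.+2%:R * t) = 2 * cos t * cos (k.+1%:R * t).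
Proof.
have -> : k%:R * t = k.+1%:R * t - t by rewrite -[k.+1]addn1 natrD; ring.
have -> : k.+2%:R * t = k.+1%:R * t + t by rewrite -[k.+2]addn1 natrD; ring.
rewrite cosB cosD; ring.
Qed.

Lemma mul_nat_pi_div (R : realType) (n : nat) : n.+1%:R * (pi / n.+1%:R) = pi :> R.
Proof. by rewrite mulrCA mulfV ?mulr1// pnatr_eq0. Qed.

Lemma sin_nat_pi_div_gt0 (R : realType) (n k : nat) : (0 < k)%N -> (k <= n)%N ->
  0 < sin (k%:R * (pi / n.+1%:R)) :> R.
Proof.
move=> k0 kn; apply: sin_gt0_pi; rewrite mulr_gt0 ?divr_gt0 ?pi_gt0 ?ltr0n//=.
by rewrite -[ltRHS](mul_nat_pi_div R n) ltr_pM2r ?divr_gt0 ?pi_gt0 ?ltr0n// ltr_nat.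
Qed.

(* Completing squares against the positive solution [s k = sin (k t)] of
   [s k + s k.+2 = 2 cos t * s k.+1]. *)
Lemma path_partial_form_ge (R : realType) (n : nat) (u : nat -> R) :
  let t := pi / n.+1%:R in
  u 0 = 0 -> forall j, (j < n)%N ->
  sin (j.+2%:R * t) * u j.+1 ^+ 2 + sin (j.+1%:R * t) * (u j.+1 * u j.+2)
  <= sin (j.+1%:R * t) * \sum_(i < j.+1) u i.+1 * (u i + 2 * cos t * u i.+1 + u i.+2).
Proof.
move=> t u0; elim=> [|j IH] j_lt.
  rewrite big_ord1 /= u0 add0r; have := sin_recurrence t 0.
  rewrite mul0r sin0 add0r => ->; rewrite le_eqVlt; apply/orP; left; apply/eqP; ring.
rewrite big_ord_recr /=; have := IH (ltnW j_lt); have := sin_recurrence t j.+1.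
have := @sin_nat_pi_div_gt0 R n j.+1 isT (ltnW j_lt); rewrite -/t.
have := @sin_nat_pi_div_gt0 R n j.+2 isT j_lt; rewrite -/t.
set s1 := sin (j.+1%:R * t); set s2 := sin _; set s3 := sin _.
set T := \sum_(_ < _) _; set a := u j.+1; set b := u j.+2; set d := u j.+3.
move=> s2_gt0 s1_gt0 rec IHj; have := sqr_ge0 (s2 * a + s1 * b).
have -> : s2 * (T + b * (a + 2 * cos t * b + d))
    = s2 * T + s2 * (a * b) + (2 * cos t * s2) * b ^+ 2 + s2 * (b * d) by ring.
rewrite -rec => sq_ge0.
(* After multiplication by [s1], the induction hypothesis times [s2] leaves the square
   [(s2 * a + s1 * b) ^+ 2] as lower bound. *)
suff : 0 <= s1 * (s2 * T + s2 * (a * b) + s1 * b ^+ 2).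
  by rewrite pmulr_rge0// => ?; lra.
nra.
Qed.

(** At the last index of the partial inequality the left side vanishes, by [sin pi = 0] and the zero
    past the end of the path. *)
Lemma path_form_ge (R : realType) (n : nat) (v : 'cV[R]_n) : (0 < n)%N ->
  path_min R n * \sum_(i < n) v i 0 ^+ 2 <= bform (adjP R n) v v.
Proof.
case: n v => // n v _; have [u [u0 un ->]] := col_ext v.
have un2 : u n.+2 = 0 by exact: un.
rewrite bformE adjP_col// -subr_ge0 mulr_sumr -sumrB.
have := @path_partial_form_ge R n.+1 u u0 n (ltnSn n).
rewrite mul_nat_pi_div sinpi mul0r add0r un2 !mulr0.
rewrite pmulr_rge0 ?sin_nat_pi_div_gt0//.
congr (0 <= _); apply: eq_bigr => i _; rewrite !mxE /path_min; ring.
Qed.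

(** The alternating sign turns the eigenvector of the largest eigenvalue [2 cos t] into one for
    [- 2 cos t]. *)
Definition path_eigvec (R : realType) (n k : nat) : R :=
  (-1) ^+ k * sin (k%:R * (pi / n.+1%:R)).
Arguments path_eigvec R n k : clear implicits.

Lemma path_eigvec_rec (R : realType) (n k : nat) :
  path_eigvec R n k + path_eigvec R n k.+2 = path_min R n * path_eigvec R n k.+1.
Proof.
rewrite /path_eigvec /path_min !exprS.
transitivity ((-1) ^+ k * (2 * cos (pi / n.+1%:R) * sin (k.+1%:R * (pi / n.+1%:R)) : R)).
  rewrite -sin_recurrence; ring.
ring.
Qed.

Lemma path_eigvec0 (R : realType) (n : nat) : path_eigvec R n 0 = 0.
Proof. by rewrite /path_eigvec mul0r sin0 mulr0. Qed.

Lemma path_eigvec_end (R : realType) (n : nat) : path_eigvec R n n.+1 = 0.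
Proof. by rewrite /path_eigvec mul_nat_pi_div sinpi mulr0. Qed.

Lemma adjP_eigvec (R : realType) (n : nat) :
  adjP R n *m \col_(i < n) path_eigvec R n i.+1
  = path_min R n *: \col_(i < n) path_eigvec R n i.+1.
Proof.
rewrite adjP_col ?path_eigvec0 ?path_eigvec_end//; apply/matrixP => i j.
by rewrite !mxE path_eigvec_rec.
Qed.

Lemma path_eigvec_neq0 (R : realType) (n : nat) :
  (0 < n)%N -> \col_(i < n) path_eigvec R n i.+1 != 0.
Proof.
move=> n_gt0; apply/eqP => /matrixP/(_ (Ordinal n_gt0) 0)/eqP; rewrite !mxE /path_eigvec.
by rewrite mulf_eq0 signr_eq0 /= gt_eqF// sin_nat_pi_div_gt0.
Qed.

(** [path_eigvec] attains the value, and [path_form_ge] at an eigenvector bounds every eigenvalue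
    from below. [eigenvalue] refers to row vectors, hence the transposes. *)
Lemma min_ev_adjP (R : realType) (n : nat) :
  (0 < n)%N -> min_ev (adjP R n) = path_min R n.
Proof.
move=> n_gt0; apply: inf_minimum => [|a /eigenvalueP[w wA w0]] /=.
  apply/eigenvalueP; exists (\col_(i < n) path_eigvec R n i.+1)^T.
    by rewrite -{1}(adjP_sym R n) -trmx_mul adjP_eigvec linearZ.
  by rewrite trmx_eq0 path_eigvec_neq0.
have wT0 : w^T != 0 by rewrite trmx_eq0.
have := path_form_ge w^T n_gt0.
rewrite bformE -{1}(adjP_sym R n) -trmx_mul wA linearZ /=.
move=> form_ge; rewrite -(ler_pM2r (sum_sq_gt0 wT0)); apply: le_trans form_ge _.
by rewrite mulr_sumr ler_sum// => i _; rewrite !mxE mulrCA expr2.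
Qed.

Lemma path_minE (R : realType) (n : nat) :
  path_min R n = 4 * sin (pi / (2 * n.+1%:R)) ^+ 2 - 2.
Proof.
rewrite /path_min; have -> : pi / n.+1%:R = (pi / (2 * n.+1%:R)) *+ 2 :> R.
  by rewrite mulr2n invfM mulrA -mulrDl; congr (_ / _); field.
rewrite cos_mulr2n; have := cos2Dsin2 (pi / (2 * n.+1%:R) : R); lra.
Qed.

Lemma path_min_gtN2 (R : realType) (n : nat) : (0 < n)%N -> - 2 < path_min R n.
Proof.
move=> n_gt0; rewrite path_minE ltrBrDr addNr mulr_gt0// exprn_gt0// sin_gt0_pi//.
rewrite divr_gt0 ?pi_gt0 ?mulr_gt0 ?ltr0n//=.
rewrite ltr_pdivrMr ?mulr_gt0 ?ltr0n// ltr_pMr ?pi_gt0//.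
by rewrite -natrM ltr1n mulnS.
Qed.

Lemma psd_fanN2 (R : realType) (n : nat) : (0 < n)%N -> psd (fan n (- 2 : R)).
Proof.
move=> n_gt0 v; rewrite bform_fan; have := path_form_ge v n_gt0.
have := path_min_gtN2 R n_gt0; set N := \sum_(i < n) _ ^+ 2.
have : 0 <= N by rewrite sumr_ge0// => i _; rewrite sqr_ge0.
nra.
Qed.

(** When the recurrence is summed, the two shifted sums differ from the sum itself only by boundary
    terms. *)
Lemma sum_recurrence (R : realType) (x : R) (u : nat -> R) (n : nat) :
  (forall k, u k + u k.+2 = x * u k.+1) ->
  (2 - x) * \sum_(i < n) u i.+1 = u 1%N + u n - u 0 - u n.+1.
Proof.
move=> rec; elim: n => [|n IH]; first by rewrite big_ord0; ring.
rewrite big_ord_recr /= mulrDr IH mulrBl -rec; ring.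
Qed.

(** * Semidefiniteness of the fan form *)

(** [fan n x] is the leading block of [fan n.+1 x], so extending by zero preserves the form. *)
Lemma psd_fan_pred (R : realType) (n : nat) (x : R) : psd (fan n.+1 x) -> psd (fan n x).
Proof.
move=> psd_x v; have [u [u0 un ->]] := col_ext v.
have un1 : u n.+1 = 0 by exact: un.
have un2 : u n.+2 = 0 by exact: un.
have := psd_x (\col_(i < n.+1) u i.+1); rewrite !bformE.
rewrite big_ord_recr /= [X in _ + X * _]mxE un1 mul0r addr0.
congr (0 <= _); apply: eq_bigr => i _.
by rewrite !fan_col//= !mxE big_ord_recr /= un1 addr0.
Qed.

Lemma mul_nat_pi_div_pred (R : realType) (n : nat) :
  n%:R * (pi / n.+1%:R) = pi - pi / n.+1%:R :> R.
Proof. by apply/eqP; rewrite eq_sym subr_eq -[X in _ + X]mul1r -mulrDl natr1 mul_nat_pi_div. Qed.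

Lemma sum_path_eigvec (R : realType) (n : nat) :
  (2 - path_min R n) * \sum_(i < n) path_eigvec R n i.+1
  = - (1 - (-1) ^+ n) * sin (pi / n.+1%:R).
Proof.
rewrite (sum_recurrence n (@path_eigvec_rec R n)) path_eigvec0 path_eigvec_end !subr0.
rewrite /path_eigvec expr1 mul1r.
rewrite mul_nat_pi_div_pred sinB sinpi cospi; ring.
Qed.

Lemma bform_fan_eigvec (R : realType) (n : nat) (x : R) :
  let w := \col_(i < n) path_eigvec R n i.+1 in
  bform (fan n x) w w = (path_min R n - x) * (\sum_(i < n) w i 0 ^+ 2)
    - (x + 2) * (\sum_(i < n) path_eigvec R n i.+1) ^+ 2.
Proof.
move=> w; rewrite bform_fan bformE adjP_eigvec -/w.
have -> : \sum_(i < n) w i 0 = \sum_(i < n) path_eigvec R n i.+1.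
  by apply: eq_bigr => i _; rewrite mxE.
have -> : \sum_(i < n) w i 0 * (path_min R n *: w) i 0
          = path_min R n * \sum_(i < n) w i 0 ^+ 2.
  by rewrite mulr_sumr; apply: eq_bigr => i _; rewrite [X in _ * X]mxE mulrCA expr2.
ring.
Qed.

Lemma path_min_le0 (R : realType) (n : nat) : (0 < n)%N -> path_min R n <= 0.
Proof.
move=> n_gt0; rewrite /path_min mulNr oppr_le0 mulr_ge0// cos_ge0_pihalf//.
rewrite (@le_trans _ _ 0) ?oppr_le0 ?divr_ge0 ?pi_ge0//=.
by rewrite ler_pM2l ?pi_gt0// lef_pV2 ?posrE// ler_nat ltnS.
Qed.

Lemma psd_fan_le_even (R : realType) (n : nat) (x : R) : (0 < n)%N -> ~~ odd n ->
  psd (fan n x) -> x <= path_min R n.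
Proof.
move=> n_gt0 n_even psd_x; have := psd_x (\col_(i < n) path_eigvec R n i.+1).
have := sum_path_eigvec R n; rewrite -signr_odd (negPf n_even) subrr oppr0 mul0r.
move/eqP; rewrite mulf_eq0 gt_eqF/=; last first.
  by rewrite subr_gt0 (le_lt_trans (path_min_le0 R n_gt0)).
rewrite bform_fan_eigvec => /eqP ->; rewrite expr0n mulr0 subr0.
by rewrite pmulr_lge0 ?subr_ge0// sum_sq_gt0// path_eigvec_neq0.
Qed.

(** If [x >= path_min R n > -2], both terms of [bform_fan_eigvec] are at most zero, and the second
    is negative since for odd [n] the eigenvector has nonzero sum. *)
Lemma psd_fan_lt_odd (R : realType) (n : nat) (x : R) : odd n ->
  psd (fan n x) -> x < path_min R n.
Proof.
move=> n_odd psd_x; have n_gt0 : (0 < n)%N by case: n n_odd {psd_x}.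
have := psd_x (\col_(i < n) path_eigvec R n i.+1).
have min_gtN2 := path_min_gtN2 R n_gt0.
have := sum_sq_gt0 (path_eigvec_neq0 R n_gt0).
have : \sum_(i < n) path_eigvec R n i.+1 != 0.
  apply/eqP => s0; have := sum_path_eigvec R n; rewrite s0 mulr0 -signr_odd n_odd.
  have := @sin_nat_pi_div_gt0 R n 1 isT n_gt0; rewrite mul1r expr1; lra.
rewrite bform_fan_eigvec; set s := \sum_(_ < _) _; set N := \sum_(_ < _) _ ^+ 2.
move=> s0 N0; rewrite ltNge => x_ge; apply/negP => x_le.
have : 0 < s ^+ 2 by rewrite exprn_even_gt0.
nra.
Qed.

(** From [cos (2 pi / 3) = - cos (pi / 3)], the value is the positive root of [2 c^2 + c - 1]. *)
Lemma cos_pi3 (R : realType) : cos (pi / 3) = 1 / 2 :> R.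
Proof.
have c0 : 0 < cos (pi / 3) :> R.
  apply: cos_gt0_pihalf; rewrite (@lt_trans _ _ 0) ?oppr_lt0 ?divr_gt0 ?pi_gt0//=.
  by rewrite ltr_pM2l ?pi_gt0// ltf_pV2 ?posrE// ltr_nat.
have := cos_mulr2n (pi / 3 : R); have -> : (pi / 3) *+ 2 = pi - pi / 3 :> R by field.
rewrite cosB cospi sinpi; nra.
Qed.

(** For [l = path_min R n] this says [(n + 1) (l + 2) <= 2 - l]. Equality holds at [n = 2], which
    needs the exact cosine; from [n = 4] on, [sin x <= x] and [pi < 4] suffice. *)
Lemma sin_sq_pi_div_le (R : realType) (n : nat) : (2 <= n)%N -> ~~ odd n ->
  n.+2%:R * sin (pi / (2 * n.+1%:R)) ^+ 2 <= 1 :> R.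
Proof.
move=> n_ge2 n_even; have [->|n_neq2] := eqVneq n 2%N.
  by have := path_minE R 2; rewrite /path_min cos_pi3; lra.
have n_ge4 : (4 <= n)%N by case: n n_ge2 n_even n_neq2 => [|[|[|[|]]]].
have N_ge5 : 5 <= n.+1%:R :> R by rewrite ler_nat.
rewrite -[n.+2]addn1 natrD; move: (n.+1%:R) N_ge5 => N N_ge5.
have pi_lt4 : pi < 4 :> R by have := pihalf_lt2 R; lra.
have pi0 := pi_gt0 R; set x := pi / (2 * N).
have x0 : 0 <= x by rewrite /x divr_ge0//; lra.
have sx : sin x ^+ 2 <= x ^+ 2.
  rewrite ler_sqr ?nnegrE// ?sin_le// sin_ge0_pi// x0/= /x ler_pdivrMr; nra.
have xN : x * N = pi / 2 by rewrite /x; field; lra.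
have : (N + 1) * (x ^+ 2) <= 1; last by nra.
have : (N + 1) * (x * N) ^+ 2 <= N ^+ 2.
  rewrite xN; have : (pi / 2 : R) ^+ 2 <= 4 by nra.
  nra.
rewrite exprMn mulrA ger_pMl// exprn_gt0//; lra.
Qed.

(* [u k = (1 - (-1)^k cos (k t)) / (2 - l)] solves [(A - l) u = 1], so Cauchy-Schwarz
   for [A - l] bounds the square of the sum of [v] by [bform (A - l) v v] times the
   sum of [u], which is [(n + 1) / (2 - l)]. *)
Lemma psd_fan_even (R : realType) (n : nat) : (2 <= n)%N -> ~~ odd n ->
  psd (fan n (path_min R n)).
Proof.
move=> n_ge2 n_even; have n_gt0 := ltnW n_ge2.
have le0 := path_min_le0 R n_gt0; have gtN2 := path_min_gtN2 R n_gt0.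
have bnd := sin_sq_pi_div_le R n_ge2 n_even; have lE := path_minE R n.
set l := path_min R n in le0 gtN2 lE *.
pose z k : R := (-1) ^+ k * cos (k%:R * (pi / n.+1%:R)).
have z_rec k : z k + z k.+2 = l * z k.+1.
  rewrite /z /l /path_min !exprS.
  transitivity ((-1) ^+ k * (2 * cos (pi / n.+1%:R) * cos (k.+1%:R * (pi / n.+1%:R)) : R)).
    rewrite -cos_recurrence; ring.
  ring.
have z0 : z 0 = 1 by rewrite /z mul0r cos0 mulr1.
have z1 : z 1%N = l / 2 by rewrite /z /l /path_min mul1r; field.
(* Evenness of [n] enters here: the sign cancels [cos pi = -1], so that [u] vanishes at both
   ends. *)
have zn1 : z n.+1 = 1.
  by rewrite /z mul_nat_pi_div cospi -signr_odd /= n_even expr1 mulrNN mulr1.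
have zn : z n = l / 2.
  rewrite /z -signr_odd (negPf n_even) mul1r.
  by rewrite mul_nat_pi_div_pred cosB sinpi cospi /l /path_min; field.
have sum_z : \sum_(i < n) z i.+1 = -1.
  have := sum_recurrence n z_rec; rewrite z0 z1 zn1 zn => sz.
  have : (2 - l) * (\sum_(i < n) z i.+1 + 1) = 0 by rewrite mulrDr sz; field.
  by move/eqP; rewrite mulf_eq0 gt_eqF/= ?addr_eq0 => [/eqP|]; last by lra.
pose u k : R := (1 - z k) / (2 - l).
have u0 : u 0 = 0 by rewrite /u z0 subrr mul0r.
have un1 : u n.+1 = 0 by rewrite /u zn1 subrr mul0r.
pose h := \col_(i < n) u i.+1.
have sum_u : \sum_(i < n) u i.+1 = n.+1%:R / (2 - l).
  by rewrite -mulr_suml sumrB sum_z sumr_const card_ord opprK natr1.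
pose B := adjP R n - l%:M.
have B_sym : B^T = B by rewrite /B linearB /= adjP_sym tr_scalar_mx.
have BE v : bform B v v = bform (adjP R n) v v - l * \sum_(i < n) v i 0 ^+ 2.
  rewrite !bformE mulr_sumr -sumrB; apply: eq_bigr => i _.
  by rewrite mulmxBl mul_scalar_mx !mxE; ring.
have B_psd : psd B by move=> v; rewrite BE subr_ge0 path_form_ge.
have Bh : B *m h = const_mx 1.
  apply/matrixP => i j; rewrite mulmxBl mul_scalar_mx adjP_col// !mxE.
  have -> : u i + u i.+2 - l * u i.+1
            = (2 - l - (z i + z i.+2 - l * z i.+1)) / (2 - l) by rewrite /u; ring.
  by rewrite z_rec subrr subr0 mulfV// gt_eqF//; lra.
move=> v; have := cauchy_schwarz_psd v h B_sym B_psd.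
have -> : bform B v h = \sum_(i < n) v i 0.
  by rewrite bformE Bh; apply: eq_bigr => i _; rewrite mxE mulr1.
have -> : bform B h h = n.+1%:R / (2 - l).
  by rewrite bformE Bh -sum_u; apply: eq_bigr => i _; rewrite !mxE mulr1.
have := B_psd v; rewrite bform_fan; move: (BE v).
set s := \sum_(i < n) v i 0; set E := bform B v v => EE E0 sE.
suff : (l + 2) * s ^+ 2 <= E by lra.
apply: (@le_trans _ _ ((l + 2) * (E * (n.+1%:R / (2 - l))))).
  by rewrite ler_pM2l//; lra.
rewrite mulrCA ler_piMr// mulrA ler_pdivrMr ?mul1r; last by lra.
(* In terms of [l], [bnd] is the required [(l + 2) (n + 1) <= 2 - l]. *)
move: bnd; rewrite -[n.+2]addn1 natrD; nra.
Qed.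

(** * The characteristic function Phi *)

Lemma chebUt0 (R : realType) (x : R) : chebUt 0 x = 1. Proof. by []. Qed.

Lemma chebUt1 (R : realType) (x : R) : chebUt 1 x = x.
Proof. by rewrite /chebUt /=; field. Qed.

Lemma chebUt_rec (R : realType) (x : R) (k : nat) :
  chebUt k x + chebUt k.+2 x = x * chebUt k.+1 x.
Proof. by rewrite /chebUt /=; field. Qed.

(** The left side is an invariant of the three-term recurrence. *)
Lemma chebUt_quadratic (R : realType) (x : R) (k : nat) :
  chebUt k.+1 x ^+ 2 + chebUt k x ^+ 2 - x * chebUt k.+1 x * chebUt k x = 1.
Proof.
elim: k => [|k IH]; first by rewrite chebUt0 chebUt1; ring.
have -> : chebUt k.+2 x = x * chebUt k.+1 x - chebUt k x.
  by rewrite -chebUt_rec addrC addKr.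
rewrite -[RHS]IH; ring.
Qed.

(* The solutions of [u k + u k.+2 - x * u k.+1 = (2 - x) * C] with [u 0 = 0]. *)
Definition cheb_sol (R : realType) (x C B : R) (k : nat) : R :=
  C * (1 - chebUt k x) + B * (if k is k'.+1 then chebUt k' x else 0).

Lemma cheb_sol0 (R : realType) (x C B : R) : cheb_sol x C B 0 = 0.
Proof. by rewrite /cheb_sol chebUt0; ring. Qed.

Lemma cheb_sol1 (R : realType) (x C B : R) : cheb_sol x C B 1 = C * (1 - x) + B.
Proof. by rewrite /cheb_sol chebUt0 chebUt1; ring. Qed.

Lemma cheb_sol_rec (R : realType) (x C B : R) (k : nat) :
  cheb_sol x C B k + cheb_sol x C B k.+2 = x * cheb_sol x C B k.+1 + (2 - x) * C.
Proof.
have := chebUt_rec x k; rewrite /cheb_sol; case: k => [|k].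
  by rewrite chebUt0 chebUt1 => /(canRL (addKr _)) ->; ring.
have := chebUt_rec x k => /(canRL (addKr _)) -> /(canRL (addKr _)) ->; ring.
Qed.

Lemma cheb_sol_end (R : realType) (x C B : R) (n : nat) :
  cheb_sol x C B n.+2
  = C * (1 - x * chebUt n.+1 x + chebUt n x) + B * chebUt n.+1 x.
Proof.
by rewrite /cheb_sol (canRL (addKr _) (chebUt_rec x n)); ring.
Qed.

(** Subtracting the constant particular solution [C] leaves a homogeneous solution, to which
    [sum_recurrence] applies. *)
Lemma sum_cheb_sol (R : realType) (x C B : R) (n : nat) :
  let a := chebUt n.+1 x in let b := chebUt n x in
  (2 - x) * \sum_(i < n.+1) cheb_sol x C B i.+1
  = C * ((2 - x) * n.+1%:R - (x + a - 1 - x * a + b)) + B * (1 + b - a).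
Proof.
move=> a b; have rec k : cheb_sol x C B k - C + (cheb_sol x C B k.+2 - C)
    = x * (cheb_sol x C B k.+1 - C).
  have := cheb_sol_rec x C B k => /(canRL (addKr _)) ->; ring.
have -> : \sum_(i < n.+1) cheb_sol x C B i.+1
    = \sum_(i < n.+1) (cheb_sol x C B i.+1 - C) + C * n.+1%:R.
  by rewrite sumrB sumr_const card_ord mulr_natr subrK.
rewrite mulrDr (sum_recurrence (u := fun k => cheb_sol x C B k - C) n.+1 rec).
rewrite cheb_sol0 cheb_sol1 cheb_sol_end -/a -/b {1}/cheb_sol -/a -/b; ring.
Qed.

(** The rows in [(C, B)] are the end condition [cheb_sol x C B n.+2 = 0] and [2 - x] times the
    requirement that [x + 2] times the sum be [(2 - x) * C]. The invariant [chebUt_quadratic]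
    accounts for the difference from [Phi]. *)
Lemma Phi_determinant (R : realType) (x : R) (n : nat) :
  let a := chebUt n.+1 x in let b := chebUt n x in
  Phi n.+1 x
  = (1 - x * a + b) * ((2 + x) * (1 + b - a))
    - a * ((2 + x) * ((2 - x) * n.+1%:R - (x + a - 1 - x * a + b)) - (2 - x) ^+ 2).
Proof.
move=> a b; have := chebUt_quadratic x n; rewrite -/a -/b => ab.
apply/eqP; rewrite -subr_eq0 /Phi /= -/a -/b -natr1.
apply/eqP; transitivity ((x + 2) * (1 - (a ^+ 2 + b ^+ 2 - x * a * b))); first ring.
by rewrite ab subrr mulr0.
Qed.

Lemma singular2 (R : realType) (a b c d : R) : a * d - b * c = 0 ->
  exists C B, [/\ (C != 0) || (B != 0), C * a + B * b = 0 & C * c + B * d = 0].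
Proof.
move=> det0; have [/andP[/eqP a0 /eqP b0]|ab0] := boolP ((a == 0) && (b == 0)); last first.
  exists b, (- a); rewrite oppr_eq0 orbC -negb_and; split=> //; first by ring.
  by rewrite -[RHS]oppr0 -det0; ring.
have [/andP[/eqP c0 /eqP d0]|cd0] := boolP ((c == 0) && (d == 0)).
  by exists 1, 0; rewrite a0 b0 c0 d0 oner_eq0 !mulr0 addr0.
by exists d, (- c); rewrite oppr_eq0 orbC -negb_and a0 b0; split=> //; ring.
Qed.

Lemma Phi_root_ker (R : realType) (n : nat) (x : R) : (0 < n)%N -> x != 2 ->
  Phi n x = 0 -> exists2 v : 'cV[R]_n, v != 0 & fan n x *m v = 0.
Proof.
case: n => // n _ x2; rewrite Phi_determinant => /singular2[C [B [CB eq1 eq2]]].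
have x2' : 2 - x != 0 by rewrite subr_eq0 eq_sym.
have end0 : cheb_sol x C B n.+2 = 0 by rewrite cheb_sol_end.
have sumE : (x + 2) * \sum_(i < n.+1) cheb_sol x C B i.+1 = (2 - x) * C.
  apply: (mulfI x2'); rewrite mulrCA sum_cheb_sol; apply/eqP; rewrite -subr_eq0 -eq2.
  by apply/eqP; ring.
exists (\col_(i < n.+1) cheb_sol x C B i.+1); last first.
  apply/matrixP => i j; rewrite ord1 fan_col ?cheb_sol0// mxE sumE cheb_sol_rec; ring.
(* A zero vector has sum zero, which forces [C = 0]; its first entry is then [B]. *)
apply: contraTneq CB => /matrixP u0; rewrite negb_or !negbK.
have C0 : C = 0.
  move/eqP: sumE; rewrite big1 => [|i _]; last by have := u0 i 0; rewrite !mxE.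
  by rewrite mulr0 eq_sym mulf_eq0 (negPf x2') => /eqP.
have := u0 ord0 0; rewrite !mxE cheb_sol1 C0 mul0r add0r => ->.
by rewrite eqxx.
Qed.

(** A kernel vector is a [cheb_sol], with [C] fixed by its sum and [B] by its first entry, so
    [(C, B)] solves the 2 x 2 system. *)
Lemma ker_Phi_root (R : realType) (n : nat) (x : R) (v : 'cV[R]_n) : x != 2 ->
  v != 0 -> fan n x *m v = 0 -> Phi n x = 0.
Proof.
case: n v => [v|n v x2]; first by rewrite [v]flatmx0 eqxx.
have x2' : 2 - x != 0 by rewrite subr_eq0 eq_sym.
have [u [u0 un ->]] := col_ext v; move=> v0 /matrixP kerv.
have un2 : u n.+2 = 0 by exact: un.
set s := \sum_(i < n.+1) u i.+1; pose C := (x + 2) * s / (2 - x).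
have urec i : (i < n.+1)%N -> u i + u i.+2 = x * u i.+1 + (2 - x) * C.
  move=> i_lt; have := kerv (Ordinal i_lt) 0; rewrite fan_col// mxE /= -/s.
  by rewrite /C mulrCA mulfV// mulr1 => /eqP; rewrite -addrA -opprD subr_eq0 => /eqP.
pose B := u 1%N - C * (1 - x).
have uE k : (k <= n.+1)%N -> u k = cheb_sol x C B k /\ u k.+1 = cheb_sol x C B k.+1.
  elim: k => [|k IH k_lt]; first by rewrite cheb_sol0 cheb_sol1 /B addrC subrK.
  have [uk uk1] := IH (ltnW k_lt); split=> //.
  by apply: (addrI (u k)); rewrite urec// uk uk1 cheb_sol_rec.
have := cheb_sol_end x C B n; rewrite -(uE n.+1 (leqnn _)).2 un2 => /esym eq1.
have sE : s = \sum_(i < n.+1) cheb_sol x C B i.+1.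
  by apply: eq_bigr => i _; rewrite (uE i (ltnW (ltn_ord i))).2.
have := sum_cheb_sol x C B n; rewrite -sE => sumE.
have sC : (x + 2) * s = (2 - x) * C by rewrite /C mulrCA mulfV ?mulr1.
have := congr1 ( *%R (x + 2)) sumE; rewrite mulrCA sC => eq2.
set a := chebUt n.+1 x in eq1 eq2; set b := chebUt n x in eq1 eq2.
apply: contraNeq v0 => Phi0.
pose beta := (2 + x) * ((2 - x) * n.+1%:R - (x + a - 1 - x * a + b)) - (2 - x) ^+ 2.
pose delta := (2 + x) * (1 + b - a).
have PhiE : Phi n.+1 x = (1 - x * a + b) * delta - a * beta by exact: Phi_determinant.
have eq2' : C * beta + B * delta = 0.
  apply/eqP; rewrite -(subrr ((2 - x) * ((2 - x) * C))) {1}eq2 /beta /delta.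
  by apply/eqP; ring.
have C0 : C = 0.
  (* Cramer's rule: [Phi] times each unknown is a combination of the two equations. *)
  apply: (mulfI Phi0); rewrite mulr0 PhiE.
  transitivity (delta * (C * (1 - x * a + b) + B * a) - a * (C * beta + B * delta)).
    ring.
  by rewrite eq1 eq2' !mulr0 subrr.
have B0 : B = 0.
  apply: (mulfI Phi0); rewrite mulr0 PhiE.
  transitivity ((1 - x * a + b) * (C * beta + B * delta)
                - beta * (C * (1 - x * a + b) + B * a)); first ring.
  by rewrite eq1 eq2' !mulr0 subrr.
apply/eqP/matrixP => i j; rewrite !mxE (uE i (ltnW (ltn_ord i))).2.
by rewrite /cheb_sol C0 B0 !mul0r addr0.
Qed.

(** * The minimal root of Phi and the conclusion *)

Lemma alpha_t_fan (R : realType) (n : nat) (m : R) : (0 < n)%N -> m < 2 ->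
  psd (fan n m) -> (forall x, psd (fan n x) -> x <= m) -> alpha_t R n = m.
Proof.
move=> n_gt0 m_lt2 psd_m max_m; apply: inf_minimum => [|y Phi_y] /=.
  have [v v0 kerv] := fan_max_ker psd_m max_m.
  by apply: ker_Phi_root v0 kerv; rewrite lt_eqF.
rewrite leNgt; apply/negP => y_lt.
have [|v v0 kerv] := Phi_root_ker n_gt0 _ Phi_y; first by rewrite lt_eqF// (lt_trans y_lt).
(* Passing from [m] down to [y] adds a positive multiple of [m - y] to a nonnegative form, so it
   cannot vanish at [v]. *)
have : bform (fan n y) v v = 0 by rewrite bformE kerv big1// => i _; rewrite mxE mulr0.
have := psd_m v; have := sum_sq_pwD_gt0 v0; rewrite !bform_fan; nra.
Qed.

Theorem theorem4p1 (R : realType) :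
  (forall n : nat, (1 <= n)%N ->
     QEC_K1Pn R n = - alpha_t R n - 2) /\
  (forall n : nat, (2 <= n)%N -> ~~ odd n ->
     alpha_t R n = min_ev (adjP R n) /\
     QEC_K1Pn R n = - min_ev (adjP R n) - 2 /\
     - min_ev (adjP R n) - 2 = - 4 * (sin (pi / (2 * (n.+1)%:R))) ^+ 2) /\
  (forall n : nat, odd n ->
     (min_ev (adjP R n.+1) <= alpha_t R n /\ alpha_t R n < min_ev (adjP R n)) /\
     (- 4 * (sin (pi / (2 * (n.+1)%:R))) ^+ 2 < QEC_K1Pn R n /\
      QEC_K1Pn R n <= - 4 * (sin (pi / (2 * (n.+2)%:R))) ^+ 2)).
Proof.
have QEC_spec n (n_gt0 : (0 < n)%N) := QEC_fan n_gt0 (@psd_fanN2 R n n_gt0).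
have le_min n x : (0 < n)%N -> psd (fan n x) -> x <= path_min R n.
  move=> n_gt0 psd_x; case: (boolP (odd n)) => n_par.
    exact/ltW/(psd_fan_lt_odd n_par).
  exact: psd_fan_le_even.
have alphaE n : (0 < n)%N -> alpha_t R n = - QEC_K1Pn R n - 2.
  move=> n_gt0; have [psd_m max_m] := QEC_spec n n_gt0; apply: alpha_t_fan => //.
  by apply: le_lt_trans (le_min n _ n_gt0 psd_m) _; apply: le_lt_trans (path_min_le0 R n_gt0) _.
have even_eq n : (2 <= n)%N -> ~~ odd n -> - QEC_K1Pn R n - 2 = path_min R n.
  move=> n_ge2 n_even; have [psd_m max_m] := QEC_spec n (ltnW n_ge2).
  by apply/le_anti; rewrite (le_min n _ (ltnW n_ge2) psd_m) max_m//; exact: psd_fan_even.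
split=> [n n_gt0|]; first by rewrite alphaE//; ring.
split=> [n n_ge2 n_even|n n_odd].
  have n_gt0 := ltnW n_ge2; rewrite min_ev_adjP// alphaE// even_eq//; split=> //.
  by split; [rewrite -(even_eq n)//; ring | rewrite path_minE; ring].
have n_gt0 : (0 < n)%N by case: n n_odd.
have [psd_m max_m] := QEC_spec n n_gt0.
have upper := psd_fan_lt_odd n_odd psd_m.
(* As [n.+1] is even, its fan form is semidefinite at [path_min R n.+1], and this restricts to
   [n]. *)
have lower : path_min R n.+1 <= - QEC_K1Pn R n - 2.
  by apply/max_m/psd_fan_pred/psd_fan_even; rewrite //= negbK.
rewrite !min_ev_adjP// alphaE//; split=> //.
by move: upper lower; rewrite !path_minE; split; lra.
Qed.
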